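(* Let $q$ be a prime power, let $m\ge1$ and $t$ be integers with $t+1\mid m$, let $H(x)\in\mathbb F_q[x]$ be a monic irreducible polynomial of degree $t+1$, and let $\alpha\in\mathbb F_{q^{t+1}}^*$ be a root of $H(x)$, so that $H(x)=\prod_{i=0}^t(x-\alpha^{q^i})$. Write $\alpha_i=\alpha^{q^{i-1}}$ for $1\le i\le t+1$, and let $L\subseteq\mathbb F_{q^m}$ be a set with $\alpha_1,\ldots,\alpha_{t+1}\in L$. Let $V(x)=\lambda x^\mu$ with $\lambda\in\mathbb F_{q^m}^*$ and $\mu>0$ an integer. Let $G(x)$ be the unique remainder of $V(x)H'(x)$ modulo $H(x)$, and assume that $G(\eta)\ne0$ for every $\eta\in L$. Let $N_\alpha=\operatorname{ord}(\alpha)$ be the multiplicative order of $\alpha$. If $$\operatorname{Tr}_{\mathbb F_{q^{t+1}}/\mathbb F_q}(\alpha^\mu)\ne0\qquad\text{and}\qquad\frac{N_\alpha}{\gcd\left(N_\alpha,(q-1)^2\right)}\ \Big|\ \mu,$$ then the $q$-ary Goppa code $\Gamma(L,G)$ has minimum distance $d(\Gamma(L,G))=t+1$.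
   Context: $H'(x)$ is the formal derivative of $H(x)$; the remainder $G(x)\in\mathbb F_{q^m}[x]$ is the polynomial of degree at most $t$ of the form $G(x)=U(x)H(x)+V(x)H'(x)$ with $U(x)\in\mathbb F_{q^m}[x]$. $\operatorname{Tr}_{\mathbb F_{q^{t+1}}/\mathbb F_q}(z)=\sum_{i=0}^t z^{q^i}$ is the field trace. Enumerate $L=\{\gamma_1,\ldots,\gamma_n\}$ with $n=|L|$. For a polynomial $G(x)\in\mathbb F_{q^m}[x]$ of degree at most $n$ with no zero in $L$, the $q$-ary Goppa code with support $L$ and Goppa polynomial $G$ is $$\Gamma(L,G)=\Bigl\{(c_1,\ldots,c_n)\in\mathbb F_q^n\ \Big|\ \sum_{i=1}^n\frac{c_i}{x-\gamma_i}\equiv0\pmod{G(x)}\Bigr\},$$ where $\frac1{x-\gamma_i}$ denotes the inverse of $x-\gamma_i$ modulo $G(x)$. The minimum distance $d(\mathcal C)$ of a linear code $\mathcal C$ is the minimum number of nonzero coordinates of a nonzero codeword. *)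

(* Defs.v *)
From HB Require Import structures.
From mathcomp Require Import all_boot all_order all_algebra all_field.

Set Implicit Arguments.
Unset Strict Implicit.
Unset Printing Implicit Defensive.

Import GRing.Theory.
Local Open Scope ring_scope.

(* The inverse of p modulo g, reduced modulo g, obtained from Bezout's        *)
(* identity; meaningful when p and g are coprime (see mulp_modp_inv).         *)
Definition modp_inv (K : fieldType) (g p : {poly K}) : {poly K} :=
  let e := egcdp p g in
  ((lead_coef (e.1 * p + e.2 * g))^-1 *: e.1) %% g.

Lemma mulp_modp_inv (K : fieldType) (g p : {poly K}) :
  coprimep p g -> (p * modp_inv g p) %% g = 1 %% g.
Proof.
move=> cpg; rewrite /modp_inv modp_mul.
set e := egcdp p g; set b := e.1 * p + e.2 * g.
have sb : size b = 1%N.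
  by have /eqp_size <- := egcdpE p g; apply/eqP.
have [c c0 bE] : exists2 c, c != 0 & b = c%:P.
  by move/eqP: sb => /size_poly1P.
have -> : p * ((lead_coef b)^-1 *: e.1) = 1 - (c^-1 *: e.2) * g.
  rewrite bE lead_coefC -scalerAr [p * _]mulrC.
  have -> : e.1 * p = c%:P - e.2 * g by rewrite -bE addrK.
  by rewrite scalerBr -scalerAl -mul_polyC -polyCM mulVf.
by rewrite modpD modpN modp_mull oppr0 addr0.
Qed.

(* The support is enumerated by a tuple, meant to be duplicate-free; the      *)
(* defining congruence is read for G without zero in the support.             *)
Definition goppa_code (F : finFieldType) (K : fieldExtType F) (n : nat)
    (L : n.-tuple K) (G : {poly K}) : {set 'rV[F]_n} :=
  [set c : 'rV[F]_n |
     (\sum_(i < n) (c ord0 i)%:A *: modp_inv G ('X - (tnth L i)%:P)) %% G == 0].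

Definition hamming_weight (F : finFieldType) (n : nat) (c : 'rV[F]_n) : nat :=
  #|[set i : 'I_n | c ord0 i != 0]|.

(* A code without nonzero codeword gets the value n.+1, which exceeds every   *)
(* weight.                                                                    *)
Definition min_distance (F : finFieldType) (n : nat) (C : {set 'rV[F]_n}) : nat :=
  \big[minn/n.+1]_(c in C | c != 0) hamming_weight c.

(* The trace from the field with q ^ t.+1 elements to the one with q elements.*)
Definition finfield_trace (K : fieldType) (q t : nat) (z : K) : K :=
  \sum_(i < t.+1) z ^+ (q ^ i).

(* Main.v *)
(* Since H splits as the product of the 'X - alpha_i, with alpha_i the        *)
(* conjugates alpha ^+ (q ^ i), V * H' is congruent modulo H to the sum of    *)
(* the V(alpha_i) * H / ('X - alpha_i): G is the numerator of the sum of the  *)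
(* lambda * alpha_i ^+ mu / ('X - alpha_i), and its coefficient of degree t   *)
(* is lambda times the trace, hence deg G = t. A codeword c of weight w > 0   *)
(* gives a nonzero multiple of G of degree < w, the numerator of the sum of   *)
(* the c_i / ('X - gamma_i), so that w > t. Conversely, scaling the partial   *)
(* fraction expansion of G / H by (lambda * alpha ^+ mu)^-1 gives the         *)
(* coefficients alpha ^+ (mu * (q ^ i - 1)), which lie in F because the order *)
(* of alpha divides mu * (q - 1) ^ 2: they form a codeword of weight t + 1.   *)

Require Import Defs.
From HB Require Import structures.
From mathcomp Require Import all_boot all_order all_algebra all_field.
From mathcomp Require Import zify.

Set Implicit Arguments.
Unset Strict Implicit.
Unset Printing Implicit Defensive.

Import GRing.Theory.
Local Open Scope ring_scope.

(** Codewords and Goppa polynomial are compared through numerators of partial fractions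
    ([pfrac_num]). Interpolation at the conjugates of [alpha] ([irreducible_monic_prod_conjugates],
    [modp_mul_deriv_prod_XsubC]) makes [G] such a numerator, and the nonzero trace gives it size
    [t.+1]. Membership in the code becomes divisibility of a numerator by [G] ([mem_goppa_code]).
    Comparing degrees bounds every weight from below ([goppa_code_weight_ge]); the condition on [N]
    rescales the numerator [G] to coefficients in [F] ([expr_card_base_div]), which yields a word
    reaching the bound. *)

Lemma exprD_card_base (F : finFieldType) (K : fieldExtType F) (x y : K) :
  (x + y) ^+ #|F| = x ^+ #|F| + y ^+ #|F|.
Proof.
have [p p_pr pcharFp] := finPcharP F.
apply: exprDn_pchar; rewrite (card_pprimeChar pcharFp) pnatX pnatE //.
by rewrite pchar_lalg pcharFp.
Qed.

(** The q-th power map is additive and multiplicative and fixes the coefficients, which lie in [F],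
    so it commutes with evaluation. *)
Lemma horner_in_alg_exp_card (F : finFieldType) (K : fieldExtType F)
    (p : {poly F}) (x : K) k :
  (map_poly (in_alg K) p).[x] ^+ (#|F| ^ k) =
  (map_poly (in_alg K) p).[x ^+ (#|F| ^ k)].
Proof.
elim: k => [|k IHk]; first by rewrite expn0 !expr1.
rewrite expnSr !exprM {}IHk; move: (x ^+ _) => {}x.
elim/poly_ind: p => [|p c IHp].
  by rewrite rmorph0 !horner0 expr0n -(subnKC (finNzRing_gt1 F)).
rewrite rmorphD rmorphM /= map_polyX map_polyC /= !hornerE.
rewrite exprD_card_base exprMn IHp -in_algE.
by rewrite -[X in _ + X = _]rmorphXn expf_card.
Qed.

Lemma expr_card_base_inj (F : finFieldType) (K : fieldExtType F) k :
  injective (fun x : K => x ^+ (#|F| ^ k)).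
Proof.
elim: k => [|k IHk] x y; first by rewrite expn0 !expr1.
rewrite expnSr !exprM => E; apply: IHk; move: E.
set u := x ^+ _; set v := y ^+ _ => E.
have /eqP : (u - v) ^+ #|F| = 0.
  by apply: (addIr (v ^+ #|F|)); rewrite -exprD_card_base subrK E add0r.
by rewrite expf_eq0 subr_eq0 => /andP[_ /eqP].
Qed.

(** * Conjugates of a root of an irreducible polynomial over a finite field *)

Section IrreducibleConjugates.

Context {F : finFieldType} {K : fieldExtType F} {H : {poly F}} {alpha : K}.
Local Notation q := #|F|.
Local Notation "p ^%:A" := (map_poly (in_alg K) p)
  (at level 2, format "p ^%:A").

Hypotheses (irrH : irreducible_poly H) (Halpha : root H^%:A alpha).

(** A nonzero difference of degree less than deg [H] is coprime to [H], over [K] as well, so it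
    cannot vanish at [alpha]. *)
Lemma horner_irreducible_root_inj :
  {in [pred p : {poly F} | (size p < size H)%N] &,
    injective (fun p : {poly F} => p^%:A.[alpha])}.
Proof.
move=> p r /=; rewrite !inE => sp sr Epr; apply/eqP; rewrite -subr_eq0.
apply/negPn/negP => nz; have : coprimep H (p - r).
  rewrite irreducible_poly_coprime //; apply/negP => /(dvdp_leq nz).
  apply/negP; rewrite -ltnNge; apply: leq_ltn_trans (size_polyD _ _) _.
  by rewrite size_polyN gtn_max sp.
rewrite -(coprimep_map (in_alg K)) => /coprimep_root /(_ Halpha).
by rewrite rmorphB hornerD hornerN Epr subrr eqxx.
Qed.

(* If alpha is fixed by x |-> x ^+ (q ^ d), then so are the q ^ deg H distinct
   values at alpha of the polynomials over F of degree less than deg H. *)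
Lemma irreducible_root_exp_card_neq d :
  (0 < d)%N -> (d.+1 < size H)%N -> alpha ^+ (q ^ d) != alpha.
Proof.
move=> d_gt0 ltdH; apply/eqP => fix_alpha.
have q_gt1 : (1 < q)%N := finNzRing_gt1 F.
have qd_gt1 : (1 < q ^ d)%N by rewrite -(expn0 q) ltn_exp2l.
(* Degrees at most [d] suffice: the q^(d+1) values outnumber the possible roots of X^(q^d) - X. *)
pose ev (v : 'rV[F]_d.+1) := (rVpoly v)^%:A.[alpha].
have ev_inj : injective ev.
  move=> u v /horner_irreducible_root_inj E; apply: (can_inj rVpolyK).
  by apply: E; rewrite inE (leq_ltn_trans (size_poly _ _)).
have size_p : size ('X^(q ^ d) - 'X : {poly K}) = (q ^ d).+1.
  by rewrite size_polyDl size_polyXn // size_polyN size_polyX.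
have := @max_poly_roots K ('X^(q ^ d) - 'X) [seq ev v | v : 'rV[F]_d.+1].
rewrite -size_poly_eq0 size_p size_map -cardT card_mx mul1n => /(_ isT).
rewrite (map_inj_uniq ev_inj) enum_uniq => lt_q.
have {lt_q}: (q ^ d.+1 <= q ^ d)%N.
  apply: lt_q => //; apply/allP => _ /mapP[v _ ->].
  by rewrite rootE !hornerE horner_in_alg_exp_card fix_alpha subrr.
by rewrite leq_exp2l // ltnn.
Qed.

Lemma irreducible_conjugates_inj t :
  size H = t.+2 -> injective (fun i : 'I_t.+1 => alpha ^+ (q ^ i)).
Proof.
move=> sH.
suff lt_neq i j : (i < j < t.+1)%N ->
    alpha ^+ (q ^ i) != alpha ^+ (q ^ j).
  move=> i j E; apply: val_inj => /=; case: (ltngtP i j) => // ltij.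
    by have := lt_neq i j; rewrite ltij ltn_ord E eqxx => /(_ isT).
  by have := lt_neq j i; rewrite ltij ltn_ord E eqxx => /(_ isT).
(* Cancelling the injective power q^i leaves [alpha] fixed by the power q^(j-i). *)
case/andP=> ltij ltjt; have -> : j = (j - i + i)%N by rewrite subnK // ltnW.
rewrite expnD exprM; apply/eqP => /expr_card_base_inj /esym/eqP.
by apply/negP/irreducible_root_exp_card_neq; rewrite ?sH; lia.
Qed.

Lemma irreducible_monic_prod_conjugates t :
    H \is monic -> size H = t.+2 ->
  H^%:A = \prod_(i < t.+1) ('X - (alpha ^+ (q ^ i))%:P).
Proof.
move=> monH sH; pose rs := [seq alpha ^+ (q ^ i) | i : 'I_t.+1].
rewrite (@all_roots_prod_XsubC _ H^%:A rs).
- rewrite lead_coef_map (monicP monH) rmorph1 scale1r.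
  by rewrite big_image.
- by rewrite size_map -cardT card_ord size_map_poly.
- apply/allP => _ /mapP[i _ ->].
  rewrite rootE -horner_in_alg_exp_card (rootP Halpha) expr0n.
  by rewrite expn_eq0 -(subnKC (finNzRing_gt1 F)).
- rewrite uniq_rootsE map_inj_uniq ?enum_uniq //.
  exact: irreducible_conjugates_inj.
Qed.

End IrreducibleConjugates.

(** * Numerators of sums of simple fractions *)

Section PartialFractions.

Context {K : fieldType} {I : finType} (x : I -> K).

(* The numerator of the sum of the fractions a i / ('X - x i) for i in A. *)
Definition pfrac_num (A : {set I}) (a : I -> K) : {poly K} :=
  \sum_(i in A) a i *: \prod_(j in A | j != i) ('X - (x j)%:P).

Lemma size_prod_setD1_XsubC (A : {set I}) i : i \in A ->
  size (\prod_(j in A | j != i) ('X - (x j)%:P)) = #|A|.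
Proof.
move=> iA; rewrite -big_filter size_prod_XsubC (cardD1 i A) iA.
rewrite size_filter -sum1_count -sum1_card; congr _.+1.
by apply: eq_bigl => j; rewrite !inE andbC.
Qed.

Lemma size_pfrac_num A a : (size (pfrac_num A a) <= #|A|)%N.
Proof.
apply: leq_trans (size_sum _ _ _) _; apply/bigmax_leqP => i iA.
by apply: leq_trans (size_scale_leq _ _) _; rewrite size_prod_setD1_XsubC.
Qed.

(** Each product is monic of degree [#|A|.-1]. For [G] this coefficient is [lambda] times the
    trace. *)
Lemma coef_pfrac_num (A : {set I}) a :
  (pfrac_num A a)`_#|A|.-1 = \sum_(i in A) a i.
Proof.
rewrite coef_sum; apply: eq_bigr => i iA; rewrite coefZ.
rewrite -(size_prod_setD1_XsubC iA) -lead_coefE.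
by rewrite (monicP (monic_prod_XsubC _ _ _)) mulr1.
Qed.

Lemma pfrac_num_scale A a b :
  pfrac_num A (fun i => b * a i) = b *: pfrac_num A a.
Proof. by rewrite scaler_sumr; apply: eq_bigr => i _; rewrite scalerA. Qed.

Lemma horner_pfrac_num (A : {set I}) a k : k \in A ->
  (pfrac_num A a).[x k] = a k * \prod_(j in A | j != k) (x k - x j).
Proof.
move=> kA; rewrite horner_sum (bigD1 k) //=.
rewrite [X in _ + X]big1 ?addr0 => [|i /andP[iA ik]].
  by rewrite hornerZ horner_prod; under eq_bigr do rewrite !hornerE.
rewrite hornerZ horner_prod (bigD1 k) /=; last by rewrite kA eq_sym.
by rewrite !hornerE subrr /= mulr0 mul0r.
Qed.

Lemma deriv_prod_XsubC :
  (\prod_i ('X - (x i)%:P))^`() = pfrac_num setT (fun=> 1).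
Proof.
(* The product rule goes by induction along a list; without repetitions, [j != i] drops exactly one
   factor. *)
suff derivr (r : seq I) : uniq r -> (\prod_(i <- r) ('X - (x i)%:P))^`() =
    \sum_(i <- r) \prod_(j <- r | j != i) ('X - (x j)%:P).
  rewrite derivr ?index_enum_uniq //; apply: eq_big => i; rewrite ?inE // => _.
  by rewrite scale1r; apply: eq_bigl => j; rewrite inE.
elim: r => [_|i r IHr /= /andP[ir ur]]; first by rewrite !big_nil derivC.
rewrite !big_cons derivM derivXsubC mul1r eqxx /= IHr //; congr (_ + _).
  rewrite [RHS]big_seq_cond [LHS]big_seq; apply: eq_bigl => j.
  by case: (boolP (j \in r)) => //= jr; symmetry; apply: contraNneq ir => <-.
rewrite mulr_sumr [RHS]big_seq [LHS]big_seq; apply: eq_bigr => k kr.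
by rewrite big_cons ifT //; apply: contraNneq ir => ->.
Qed.

(** The two sides differ modulo the product Q by the terms (V - V(x_i)) Q / (X - x_i), multiples of
    Q since X - x_i divides V - V(x_i); the numerator has degree below that of Q, so it is the
    remainder. *)
Lemma modp_mul_deriv_prod_XsubC (V : {poly K}) :
  (V * (\prod_i ('X - (x i)%:P))^`()) %% \prod_i ('X - (x i)%:P) =
  pfrac_num setT (fun i => V.[x i]).
Proof.
set Q := \prod_i _; set N := pfrac_num _ _.
have szN : (size N < size Q)%N.
  rewrite size_prod_XsubC ltnS (leq_trans (size_pfrac_num _ _)) //.
  by rewrite -sum1_card -sum1_size eq_leq //; apply: eq_bigl => j; rewrite inE.
rewrite -(modp_small szN); apply/eqP.
rewrite -subr_eq0 -modpN -modpD -/(Q %| _).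
rewrite deriv_prod_XsubC mulr_sumr -sumrB.
apply: (big_ind (fun p => Q %| p)) => [|p r|i _]; first exact: dvdp0.
  exact: dvdp_add.
rewrite scale1r -mul_polyC -mulrBl /Q (bigD1 i) //=.
rewrite (eq_bigl (fun j => (j \in setT) && (j != i))); last first.
  by move=> j; rewrite inE.
by rewrite dvdp_mul // dvdp_XsubCl rootE !hornerE subrr.
Qed.

(** Multiplying by the product of the X - x_i, which is coprime to [G], preserves divisibility by
    [G] and turns each modular inverse into a cofactor. *)
Lemma dvdp_pfrac_num (G : {poly K}) (A : {set I}) a :
    (forall i, i \in A -> ~~ root G (x i)) ->
  (G %| \sum_(i in A) a i *: modp_inv G ('X - (x i)%:P)) = (G %| pfrac_num A a).
Proof.
move=> nzG; pose Q := \prod_(i in A) ('X - (x i)%:P).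
have copQ : coprimep G Q.
  rewrite /Q; elim/big_rec: _ => [|i p iA copp]; first exact: coprimep1.
  by rewrite coprimepMr copp coprimep_XsubC nzG.
set S := \sum_(i in A) _.
have dvd_diff : G %| Q * S - pfrac_num A a.
  rewrite mulr_sumr -sumrB; apply: (big_ind (fun p => G %| p)) => [|p r|i iA].
  - exact: dvdp0.
  - exact: dvdp_add.
  rewrite /Q (bigD1 i iA) /= -scalerAr mulrAC -scalerBr -mul_polyC dvdp_mull //.
  rewrite -[X in _ - X]mul1r -mulrBl dvdp_mulr // /dvdp.
  rewrite modpD modpN mulp_modp_inv ?subrr //.
  by rewrite coprimep_sym coprimep_XsubC nzG.
rewrite -(Gauss_dvdpr _ copQ); apply/idP/idP => dvd.
  by rewrite -(dvdp_subr _ dvd).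
by rewrite -(dvdp_subl _ dvd).
Qed.

End PartialFractions.

Lemma pfrac_num_imset (K : fieldType) (I J : finType) (f : I -> J) (x : J -> K)
    (A : {set I}) (a : J -> K) :
  injective f -> pfrac_num x (f @: A) a = pfrac_num (x \o f) A (a \o f).
Proof.
move=> f_inj; rewrite /pfrac_num big_imset /=; last first.
  by move=> ? ? _ _; apply: f_inj.
apply: eq_bigr => i _; congr (_ *: _).
rewrite big_mkcondr big_imset /=; last by move=> ? ? _ _; apply: f_inj.
by rewrite [RHS]big_mkcondr; apply: eq_bigr => j _; rewrite (inj_eq f_inj).
Qed.

(** * Goppa codes and their minimum distance *)

(** [A] may be any set containing the support of [c]: the support itself for the lower bound, the
    positions of the conjugates for the word of minimum weight. *)
Lemma mem_goppa_code (F : finFieldType) (K : fieldExtType F) n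
    (L : n.-tuple K) (G : {poly K}) (A : {set 'I_n}) (c : 'rV[F]_n) :
    {in L, forall eta, G.[eta] != 0} ->
    (forall i, i \notin A -> c ord0 i = 0) ->
  (c \in goppa_code L G) = (G %| pfrac_num (tnth L) A (fun i => (c ord0 i)%:A)).
Proof.
move=> nzG c0; rewrite inE -dvdp_pfrac_num => [|i _]; last first.
  by rewrite /root nzG ?mem_tnth.
rewrite [in RHS]big_mkcond /=; congr (_ %% _ == 0).
apply: eq_bigr => i _; case: ifPn => // /c0 ->.
by rewrite !scale0r.
Qed.

Lemma goppa_code_weight_ge (F : finFieldType) (K : fieldExtType F) n
    (L : n.-tuple K) (G : {poly K}) (c : 'rV[F]_n) :
    uniq L -> {in L, forall eta, G.[eta] != 0} ->
  c \in goppa_code L G -> c != 0 -> (size G <= hamming_weight c)%N.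
Proof.
move=> uL nzG; set A := [set i | c ord0 i != 0].
rewrite (mem_goppa_code (A := A) nzG) => [dvdG c_neq0|i]; last first.
  by rewrite inE negbK => /eqP.
have [k ck] : exists k, c ord0 k != 0.
  by apply/rV0Pn.
apply: leq_trans (size_pfrac_num (tnth L) A _); apply: dvdp_leq dvdG.
have kA : k \in A by rewrite inE.
(* A zero numerator, evaluated at the k-th support point, would force the k-th coordinate to be 0,
   as the points are distinct. *)
apply: contraTneq ck => num0.
have /eqP := horner_pfrac_num (tnth L) (fun i => (c ord0 i)%:A) kA.
rewrite num0 horner0 eq_sym mulf_eq0 => /orP[|/prodf_eq0[j /andP[_ jk]]].
  by rewrite scaler_eq0 oner_eq0 orbF => ->.
rewrite subr_eq0 (inj_eq (tuple_uniqP _ uL)) eq_sym (negPf jk) //.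
Qed.

Lemma min_distanceP (F : finFieldType) n (C : {set 'rV[F]_n}) d :
    (forall c, c \in C -> c != 0 -> (d <= hamming_weight c)%N) ->
    (exists2 c, c \in C & c != 0 /\ hamming_weight c = d) ->
  min_distance C = d.
Proof.
move=> ge_d [c cC [c0 wc]]; apply/eqP; rewrite eqn_leq; apply/andP; split.
  rewrite /min_distance; have := mem_index_enum c.
  elim: (index_enum _) => // b s IHs; rewrite inE big_cons.
  case: eqP => [<- _ | _ /IHs le_d]; first by rewrite cC c0 /= -wc geq_minl.
  by case: ifP => // _; rewrite geq_min le_d orbT.
apply: (big_ind (fun k => (d <= k)%N)) => [|k l dk dl|b /andP[]].
(* The default [n.+1] is at least [d], since [d] is the weight of a word of length [n]. *)
- by rewrite -wc; apply: leq_trans (max_card _) _; rewrite card_ord.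
- by rewrite leq_min dk.
- exact: ge_d.
Qed.

(* The quotients x ^+ (q ^ i) / x are (q - 1)-st powers of x, as q - 1 divides
   q ^ i - 1. *)
Lemma expr_card_base_div (F : finFieldType) (K : fieldExtType F) (x : K) i :
    x ^+ ((#|F| - 1) ^ 2) = 1 ->
  exists a : F, a%:A = x^-1 * x ^+ (#|F| ^ i).
Proof.
set q := #|F| => x1; have q_gt1 : (1 < q)%N := finNzRing_gt1 F.
have x0 : x != 0.
  apply/eqP => E; move/eqP: x1; rewrite E expr0n expn_eq0 subn_eq0 leqNgt q_gt1.
  by rewrite eq_sym oner_eq0.
suff /vlineP[a ->] : x^-1 * x ^+ (q ^ i) \in 1%AS by exists a.
have /dvdnP[k qi] : (q - 1 %| q ^ i - 1)%N by rewrite !subn1 dvdn_pred_predX.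
have qi_gt0 : (0 < q ^ i)%N by rewrite expn_gt0 (ltnW q_gt1).
rewrite -(subnK qi_gt0) addn1 exprS mulKf // qi.
(* With y = x^(k(q-1)), y^(q-1) = 1 gives y^q = y, which characterizes the elements of [F]. *)
have : (x ^+ (k * (q - 1))) ^+ (q - 1) = 1.
  by rewrite -exprM -mulnA mulnn mulnC exprM x1 expr1n.
rewrite Fermat's_little_theorem dimv1 expn1 -/q; move: (x ^+ _) => y.
by rewrite subn1 => y1; rewrite -(prednK (ltnW q_gt1)) exprS y1 mulr1.
Qed.

Theorem mainTheorem3
    (q m t : nat)
    (F : finFieldType) (hF : #|F| = q)
    (K : fieldExtType F) (hm : (1 <= m)%N) (hK : \dim {:K} = m)
    (htm : (t.+1 %| m)%N)
    (E : {subfield K}) (hE : \dim E = t.+1)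
    (H : {poly F}) (hHmonic : H \is monic) (hHirr : irreducible_poly H)
    (hHdeg : size H = t.+2)
    (alpha : K) (halphaE : alpha \in E) (halpha0 : alpha != 0)
    (halphaH : root (map_poly (in_alg K) H) alpha)
    (n : nat) (L : n.-tuple K) (hL : uniq L)
    (halphaL : forall i : 'I_t.+1, alpha ^+ (q ^ i) \in L)
    (lambda : K) (hlambda : lambda != 0) (mu : nat) (hmu : (0 < mu)%N)
    (V : {poly K}) (hV : V = lambda *: 'X^mu)
    (G : {poly K})
    (hG : G = (V * (map_poly (in_alg K) H)^`()) %% map_poly (in_alg K) H)
    (hGL : forall eta : K, eta \in L -> G.[eta] != 0)
    (N : nat) (hN : N.-primitive_root alpha)
    (hTr : finfield_trace q t (alpha ^+ mu) != 0)
    (hdvd : (N %/ gcdn N ((q - 1) ^ 2) %| mu)%N) :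
  min_distance (goppa_code L G) = t.+1.
Proof.
have HE : map_poly (in_alg K) H =
    \prod_(i < t.+1) ('X - (alpha ^+ (#|F| ^ i))%:P).
  exact: irreducible_monic_prod_conjugates.
have x_inj := irreducible_conjugates_inj hHirr halphaH hHdeg.
rewrite hF in HE x_inj; set x := (fun i : 'I_t.+1 => _) in x_inj.
pose a i := alpha ^+ mu ^+ (q ^ i).
have GE : G = lambda *: pfrac_num x setT (fun i : 'I_t.+1 => a i).
  rewrite hG HE modp_mul_deriv_prod_XsubC -pfrac_num_scale hV.
  by apply: eq_bigr => i _; rewrite !hornerE /a -!exprM mulnC.
have szG : size G = t.+1.
  have cardI : #|[set: 'I_t.+1]| = t.+1 by rewrite cardsT card_ord.
  rewrite GE size_scale //; apply/eqP; rewrite eqn_leq.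
  rewrite -[X in (_ <= X)%N && _]cardI size_pfrac_num ltnNge /=.
  (* A smaller size would make the coefficient of degree [t], hence the trace, vanish. *)
  apply/negP => /leq_sizeP/(_ t (leqnn t)) /eqP; apply/negP.
  have := coef_pfrac_num x setT (fun i : 'I_t.+1 => a i).
  rewrite cardI /= => ->; apply: etrans hTr.
  by congr (_ != 0); apply: eq_bigl => i; rewrite inE.
apply: min_distanceP => [c cC c0|].
  by rewrite -szG (goppa_code_weight_ge hL hGL).
(* With g = gcd(N, (q-1)^2), N is the product of N/g, which divides mu, and g, which divides
   (q-1)^2. *)
have am1 : alpha ^+ mu ^+ ((#|F| - 1) ^ 2) = 1.
  apply/eqP; rewrite -exprM hF -(prim_order_dvd hN).
  rewrite -(divnK (dvdn_gcdl N ((q - 1) ^ 2))).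
  exact: dvdn_mul hdvd (dvdn_gcdr _ _).
have /fin_all_exists[g gE] (i : 'I_t.+1) := expr_card_base_div i am1.
have /fin_all_exists[f fE] (i : 'I_t.+1) : exists j, x i = tnth L j.
  exact/tnthP/halphaL.
have f_inj : injective f.
  by move=> i j fij; apply: x_inj; rewrite !fE fij.
(* The entry at the position [f i] of the i-th conjugate is alpha^(mu(q^i - 1)); [pick] is
   unambiguous as [f] is injective. *)
pose c : 'rV[F]_n := \row_j if [pick i | f i == j] is Some i then g i else 0.
have cf i : c ord0 (f i) = g i.
  by rewrite mxE; case: pickP => [j /eqP/f_inj-> // | /(_ i)]; rewrite eqxx.
have c0 j : j \notin f @: setT -> c ord0 j = 0.
  rewrite mxE; case: pickP => // i /eqP<-.
  by rewrite imset_f ?inE.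
have g0 i : g i != 0.
  rewrite -(fmorph_eq0 (in_alg K)) /= gE mulf_neq0 ?invr_eq0 ?expf_neq0 //.
have suppc : [set j | c ord0 j != 0] = f @: setT.
  apply/setP => j; rewrite inE; apply/idP/imsetP; last first.
    by case=> i _ ->; rewrite cf.
  by have [/imsetP // | /c0->] := boolP (j \in f @: setT); rewrite eqxx.
have wc : hamming_weight c = t.+1.
  by rewrite /hamming_weight suppc card_imset // cardsT card_ord.
exists c; last first.
  split=> //; apply: contra_eq_neq wc => ->.
  rewrite /hamming_weight eq_card0 // => j; by rewrite inE mxE eqxx.
rewrite (mem_goppa_code hGL c0) pfrac_num_imset //.
(* The numerator of [c] is thus [G] divided by the nonzero scalar lambda alpha^mu. *)
have -> : pfrac_num (tnth L \o f) setT ((fun j => (c ord0 j)%:A) \o f)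
    = (alpha ^+ mu)^-1 *: pfrac_num x setT (fun i : 'I_t.+1 => a i).
  rewrite -pfrac_num_scale; apply: eq_bigr => i _ /=.
  rewrite cf gE hF; congr (_ *: _); apply: eq_bigr => j _; by rewrite fE.
by rewrite GE dvdpZl // dvdpZr ?invr_eq0 ?expf_neq0.
Qed.
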